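(* There exists an absolute constant $C>0$ such that the following holds. Let $c_0$ be a real constant with $0 \leq c_0 < 1/2$ and let $d \geq 1$ be an integer. If an almost-equidistant set $V \subset \mathbb{R}^d$ lies in a $d$-dimensional ball of radius $\sqrt{1/2 + c_0/(d+1)^{2/3}}$, then $V$ is finite and $$|V| \leq \frac{C\,d}{1-2c_0}.$$
   Context: A set $V \subset \mathbb{R}^d$ is called almost-equidistant if among any three distinct points of $V$, some two are at (Euclidean) distance exactly $1$ apart. *)

(* Defs.v *)
From mathcomp Require Import all_boot all_order all_algebra finmap.
From mathcomp Require Import all_classical all_reals all_analysis.

Set Implicit Arguments.
Unset Strict Implicit.
Unset Printing Implicit Defensive.

Import Order.TTheory GRing.Theory Num.Theory.
Local Open Scope classical_set_scope.
Local Open Scope ring_scope.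

(* Euclidean norm; the canonical norm of 'rV[R]_d is the sup norm. *)
Definition enorm (R : realType) (d : nat) (u : 'rV[R]_d) : R :=
  Num.sqrt (\sum_(i < d) u ord0 i ^+ 2).

Definition almost_equidistant (R : realType) (d : nat) (V : set 'rV[R]_d) :
    Prop :=
  forall x y z : 'rV[R]_d, V x -> V y -> V z ->
    x <> y -> y <> z -> x <> z ->
    [\/ enorm (x - y) = 1, enorm (y - z) = 1 | enorm (x - z) = 1].

(* Main.v *)
Require Import Defs.
From mathcomp Require Import all_boot all_order all_algebra finmap.
From mathcomp Require Import all_classical all_reals all_analysis.
From mathcomp Require Import ring lra.

Set Implicit Arguments.
Unset Strict Implicit.
Unset Printing Implicit Defensive.

(* Put the centre of the ball at the origin and let [m = d + 1],
   [e = c0 / m^(2/3)], [a_i = 1/2 - |x_i|^2 >= -e] and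
   [U_ij = 1 - |x_i - x_j|^2 = 2 <x_i, x_j> + a_i + a_j]. One may assume
   [c0 >= 1/4].

   Deep points ([a_i > 3 e]): the points at non-unit distance from [x_i] form a
   regular unit simplex, which bounds the row sums of [U] from above, while the
   sum of all entries of [U] is at least [2 n sum_i a_i]; hence [n <= 3 m].

   Shell points ([-e <= a_i <= 3 e]): [U = P - y^T y] with [P] positive
   semidefinite of rank at most [m] and [|y|^2 <= 2 e n]. Since the graph of
   non-unit distances is triangle-free, [tr ((U - 1)^3) = 0]. If [-mu] is the
   negative eigenvalue of [U], then [0 <= mu <= 2 e n], and replacing it by [0]
   leaves a positive semidefinite matrix of rank at most [m] and trace [n + mu];
   convexity of [l^3 - 3 l^2] turns the trace identity into
   [(n + mu)^2 (n + mu - 3 m) <= m^2 (mu^3 + 3 mu^2)], so that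
   [n (1 - (2 c0)^3) <= 6 m]. *)

Import Order.TTheory GRing.Theory Num.Theory.
Local Open Scope ring_scope.

(** * Positive semidefinite matrices over an ordered field *)

Definition psd (R : realFieldType) n (S : 'M[R]_n) : Prop :=
  forall z : 'rV_n, 0 <= \tr (z *m S *m z^T).

Section PositiveSemidefinite.
Variables (R : realFieldType) (n : nat).
Implicit Types (S U P : 'M[R]_n) (x y z : 'rV[R]_n).

Lemma mxtrace_mul_tr_ge0 m (Z : 'M[R]_(m, n)) : 0 <= \tr (Z *m Z^T).
Proof.
apply: sumr_ge0 => i _; rewrite mxE; apply: sumr_ge0 => j _.
by rewrite mxE -expr2 sqr_ge0.
Qed.

Lemma mxtrace_mul_tr_eq0 m (Z : 'M[R]_(m, n)) :
  (\tr (Z *m Z^T) == 0) = (Z == 0).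
Proof.
apply/eqP/eqP => [h|->]; last by rewrite mul0mx mxtrace0.
have h2 i j : 0 <= Z i j * Z^T j i by rewrite mxE -expr2 sqr_ge0.
have h1 i : 0 <= (Z *m Z^T) i i by rewrite mxE sumr_ge0.
apply/matrixP => i j; rewrite mxE.
have /(_ i isT) := psumr_eq0P (fun i _ => h1 i) h.
rewrite mxE => /(psumr_eq0P (fun j _ => h2 i j)) /(_ j isT) /eqP.
by rewrite mxE mulf_eq0 orbb => /eqP.
Qed.

Lemma psd_mxtrace m (Z : 'M[R]_(m, n)) S : psd S -> 0 <= \tr (Z *m S *m Z^T).
Proof.
move=> Spsd; apply: sumr_ge0 => i _.
have := Spsd (row i Z).
rewrite /mxtrace big_ord1 -row_mul !mxE.
by congr (0 <= _); apply: eq_bigr => j _; rewrite !mxE.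
Qed.

Lemma dot_rV_tr x z : x *m z^T = (\tr (x *m z^T))%:M.
Proof. by rewrite {1}[x *m z^T]mx11_scalar /mxtrace big_ord1. Qed.

Lemma dot_rVC x z : \tr (x *m z^T) = \tr (z *m x^T).
Proof. by rewrite -mxtrace_tr trmx_mul trmxK. Qed.

(** Moving from [x] to [x - t *: (x *m S)] changes the form from 0 to [t ^+ 2 * c - 2 * t * q], with
    [q] the squared length of [x *m S]; nonnegativity for all [t] forces [q = 0]. *)
Lemma psd_ker S x : S^T = S -> psd S -> \tr (x *m S *m x^T) = 0 -> x *m S = 0.
Proof.
move=> Ssym Spsd x0; apply/eqP; rewrite -mxtrace_mul_tr_eq0.
set w := x *m S; set q := \tr _; set c := \tr (w *m S *m w^T).
have c0 : 0 <= c by apply: Spsd.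
have q0 : 0 <= q by apply: mxtrace_mul_tr_ge0.
have h t : 0 <= t ^+ 2 * c - 2 * t * q.
  have := Spsd (x - t *: w).
  rewrite mulmxBl linearB /= mulmxBr !mulmxBl !linearB /= linearZ /=.
  rewrite -!scalemxAl.
  rewrite -!scalemxAr !linearZ /= -/w -/c x0.
  have -> : w *m S *m x^T = w *m w^T by rewrite -mulmxA -{1}Ssym -trmx_mul.
  by rewrite -/q; congr (0 <= _); ring.
have c1 : c + 1 != 0 by rewrite gt_eqF ?ltr_wpDl.
(* For [c > 0] the minimiser is [q / c]; adding 1 keeps the denominator positive when [c = 0]. *)
have := h (q / (c + 1)).
have -> : (q / (c + 1)) ^+ 2 * c - 2 * (q / (c + 1)) * q
    = - ((c + 2) * (q / (c + 1)) ^+ 2) by field.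
rewrite oppr_ge0 => h1; apply/eqP.
have : q / (c + 1) = 0.
  apply/eqP; rewrite -sqrf_eq0 eq_le sqr_ge0 andbT.
  by move: h1; rewrite pmulr_rle0 // ltr_wpDl.
by move=> /(congr1 ( *%R^~ (c + 1))); rewrite mul0r divfK.
Qed.

Lemma sym_mx_projector S : S^T = S ->
  exists Pi : 'M[R]_n, [/\ Pi^T = Pi, Pi *m Pi = Pi, S *m Pi = S, Pi *m S = S
    & \tr Pi = (\rank S)%:R].
Proof.
move=> Ssym.
have [B Bfree SB] : exists2 B : 'M[R]_(\rank S, n), row_free B & (S <= B)%MS.
  by exists (row_base S); rewrite ?row_base_free ?eq_row_base.
have Gu : B *m B^T \in unitmx.
  rewrite -row_free_unit -kermx_eq0; apply/eqP/row_matrixP => i; rewrite row0.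
  set z := row i _.
  have z0 : z *m (B *m B^T) = 0.
    by apply/sub_kermxP; rewrite row_sub.
  have : z *m B = 0.
    apply/eqP; rewrite -mxtrace_mul_tr_eq0 trmx_mul mulmxA -(mulmxA z) z0.
    by rewrite mul0mx mxtrace0.
  by move/eqP; rewrite mulmx_free_eq0 // => /eqP.
pose Pi := B^T *m invmx (B *m B^T) *m B.
have PiT : Pi^T = Pi.
  by rewrite /Pi !trmx_mul trmx_inv trmxK trmx_mul trmxK mulmxA.
have SPi : S *m Pi = S.
  have /submxP[D ->] := SB.
  by rewrite /Pi !mulmxA -(mulmxA D) mulmxK.
exists Pi; split => //.
- by rewrite {2}/Pi !mulmxA {1}/Pi -(mulmxA _ B) mulmxKV.
- have := congr1 trmx SPi; rewrite trmx_mul PiT Ssym => h; exact: h.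
- by rewrite /Pi -mulmxA mxtrace_mulC -mulmxA mulVmx // mxtrace1.
Qed.

(* On the range of [S] the polynomial [l^3 - 3 l^2] lies above its tangent at
   [q], the difference being [(l - q)^2 (l + 2 q - 3)]. *)
Lemma mxtrace_cubic_tangent S m q : S^T = S -> psd S -> (\rank S <= m)%N ->
    3 <= 2 * q ->
  0 <= \tr (S *m S *m S) - 3 * \tr (S *m S) + (6 * q - 3 * q ^+ 2) * \tr S
       + (2 * q ^+ 3 - 3 * q ^+ 2) * m%:R.
Proof.
move=> Ssym Spsd rS q3.
have [Pi [PiT PiPi SPi PiS trPi]] := sym_mx_projector Ssym.
pose Z := S - q *: Pi.
have ZT : Z^T = Z by rewrite linearB linearZ /= Ssym PiT.
(* In terms of the eigenvalues [l] of [S] on its range, [h1] and [h2] concern the sums of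
   [(l - q)^2 l] and of [(l - q)^2]. *)
have h1 := psd_mxtrace Z Spsd.
have h2 := mxtrace_mul_tr_ge0 Z.
have ZS : Z *m S = S *m S - q *: S by rewrite mulmxBl -scalemxAl PiS.
rewrite ZT ZS mulmxBr !mulmxBl -!scalemxAl -!scalemxAr in h1.
rewrite -(mulmxA S S Pi) SPi in h1.
rewrite !linearB /= !linearZ /= ?linearZ /= in h1.
rewrite ZT mulmxBr !mulmxBl -!scalemxAl -!scalemxAr SPi PiS PiPi in h2.
rewrite !linearB /= !linearZ /= ?linearZ /= trPi in h2.
have q0 : 0 <= 2 * q - 3 by rewrite subr_ge0.
(* The constant term [q^2 (2 q - 3)] is nonnegative, so it may be counted [m] times instead of
   [\rank S] times. *)
have h3 : 0 <= (2 * q ^+ 3 - 3 * q ^+ 2) * (m%:R - (\rank S)%:R).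
  apply: mulr_ge0; last by rewrite subr_ge0 ler_nat.
  have -> : 2 * q ^+ 3 - 3 * q ^+ 2 = q ^+ 2 * (2 * q - 3) by ring.
  by rewrite mulr_ge0 ?sqr_ge0.
have h4 := mulr_ge0 q0 h2.
move: (addr_ge0 (addr_ge0 h1 h4) h3); congr (0 <= _); ring.
Qed.

Lemma mxtrace_sub_sq U P y z : U = P - y^T *m y ->
  \tr (z *m U *m z^T) = \tr (z *m P *m z^T) - \tr (z *m y^T) ^+ 2.
Proof.
move=> ->; rewrite mulmxBr mulmxBl linearB /=; congr (_ - _).
rewrite mulmxA -mulmxA [y *m _]dot_rV_tr dot_rVC [z *m _]dot_rV_tr.
by rewrite -scalar_mxM mxtrace_scalar mxtrace_scalar mulr1n mulr1n -expr2.
Qed.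

(** On the kernel of [P] the form of [U] is minus a square, hence 0; by [psd_ker] that kernel lies
    in the kernel of [U]. *)
Lemma psd_rank_sub_sq U P y : U^T = U -> U = P - y^T *m y -> psd P -> psd U ->
  (\rank U <= \rank P)%N.
Proof.
move=> Usym UP Ppsd Upsd.
suff h : (kermx P <= kermx U)%MS.
  have := mxrankS h; rewrite !mxrank_ker.
  have := rank_leq_row U; have := rank_leq_row P.
  by move: (\rank _) (\rank _) => a b an bn; rewrite leq_sub2lE.
apply/row_subP => i; apply/sub_kermxP; set z := row i _.
have zP : z *m P = 0 by apply/sub_kermxP; rewrite row_sub.
apply: psd_ker => //; apply/eqP; rewrite eq_le Upsd andbT.
by rewrite (mxtrace_sub_sq z UP) zP mul0mx mxtrace0 sub0r oppr_le0 sqr_ge0.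
Qed.

(** * Replacing a negative eigenvalue by 0 *)

Section NegativeEigenvector.
Variables (U P : 'M[R]_n) (x y : 'rV[R]_n) (l : R).
Hypotheses (Usym : U^T = U) (UP : U = P - y^T *m y) (Ppsd : psd P).
Hypotheses (x1 : \tr (x *m x^T) = 1) (xU : x *m U = l *: x) (l0 : l < 0).
(** Deflation: [x] becomes a null vector, and the form is unchanged on the orthogonal complement of
    [x]. *)
Let S := U - l *: (x^T *m x).

Lemma eigenvector_tr : U *m x^T = l *: x^T.
Proof. by rewrite -{1}Usym -trmx_mul xU linearZ. Qed.

Lemma unit_inner : x *m x^T = 1%:M. Proof. by rewrite dot_rV_tr x1. Qed.

Lemma deflation_ker : x *m S = 0.
Proof. by rewrite mulmxBr xU -scalemxAr mulmxA unit_inner mul1mx subrr. Qed.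

Lemma deflation_sym : S^T = S.
Proof. by rewrite linearB linearZ /= trmx_mul trmxK Usym. Qed.

(** Evaluating at [x] gives [l >= - b ^+ 2] with [b] the inner product of [x] and [y];
    Cauchy-Schwarz bounds [b ^+ 2]. *)
Lemma negative_eigen_bound : - l <= \tr (y *m y^T).
Proof.
have h := mxtrace_sub_sq x UP.
rewrite xU -scalemxAl linearZ /= x1 mulr1 in h.
rewrite h opprB lerBlDr; apply: ler_wpDr; first exact: Ppsd.
set b := \tr _; pose u := y - b *: x.
have := mxtrace_mul_tr_ge0 u.
have -> : u^T = y^T - b *: x^T by rewrite linearB linearZ.
rewrite mulmxBr /u !mulmxBl -!scalemxAl -!scalemxAr.
rewrite !linearB /= !linearZ /= ?linearZ /=.
rewrite x1 (dot_rVC y x) -/b.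
by move=> h1; rewrite -subr_ge0; move: h1; congr (0 <= _); ring.
Qed.

(* If [U] were negative at some [w] orthogonal to [x], it would be negative
   definite on the plane of [x] and [w], which meets the hyperplane orthogonal
   to [y], where [U] agrees with [P]. *)
Lemma deflation_psd : psd S.
Proof.
move=> z; pose b u := \tr (u *m y^T); pose s := \tr (z *m x^T).
pose w := z - s *: x.
have wx : \tr (w *m x^T) = 0.
  by rewrite mulmxBl linearB /= -scalemxAl linearZ /= x1 mulr1 subrr.
have -> : \tr (z *m S *m z^T) = \tr (w *m U *m w^T).
  have wS : w *m S = z *m S.
    by rewrite mulmxBl -scalemxAl deflation_ker scaler0 subr0.
  have Sw : S *m w^T = S *m z^T.
    by apply: trmx_inj; rewrite !trmx_mul !trmxK deflation_sym.
  rewrite -wS -mulmxA -Sw mulmxA mulmxBr -scalemxAr mulmxBl linearB /=.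
  have wx0 : w *m x^T = 0 by rewrite dot_rV_tr wx raddf0.
  by rewrite mulmxA wx0 mul0mx scaler0 mul0mx raddf0 subr0.
clearbody w.
have bx : \tr (x *m P *m x^T) - b x ^+ 2 = l.
  by rewrite -(mxtrace_sub_sq x UP) xU -scalemxAl linearZ /= x1 mulr1.
have bx0 : 0 < b x ^+ 2.
  rewrite -(subKr (\tr (x *m P *m x^T)) (b x ^+ 2)) bx subr_gt0.
  by rewrite (lt_le_trans l0).
(* A vector of the plane orthogonal to [y]; its coefficient on [w] is nonzero because [l < 0] forces
   [b x] to be nonzero. *)
pose u := b w *: x - b x *: w.
have bu : b u = 0.
  rewrite /b mulmxBl -!scalemxAl linearB !linearZ /= -/(b x) -/(b w); ring.
have : 0 <= \tr (u *m U *m u^T).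
  by rewrite (mxtrace_sub_sq u UP) -/(b u) bu expr0n subr0.
have -> : \tr (u *m U *m u^T) = b w ^+ 2 * l + b x ^+ 2 * \tr (w *m U *m w^T).
  have xw : \tr (x *m w^T) = 0 by rewrite dot_rVC.
  have -> : u^T = b w *: x^T - b x *: w^T by rewrite linearB !linearZ.
  rewrite mulmxBr -!scalemxAr linearB !linearZ /=.
  rewrite -(mulmxA u U x^T) eigenvector_tr -scalemxAr linearZ /=.
  rewrite /u !mulmxBl -!scalemxAl xU -!scalemxAl !linearB /= !linearZ /=.
  rewrite x1 wx xw; ring.
move=> h; rewrite -(pmulr_rge0 _ bx0).
have : b w ^+ 2 * l <= 0 by rewrite mulr_ge0_le0 ?sqr_ge0 ?ltW.
by lra.
Qed.

Lemma deflation_sq : S *m S = U *m U - l ^+ 2 *: (x^T *m x).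
Proof.
rewrite {2}/S mulmxBr -scalemxAr mulmxA.
have -> : S *m x^T = 0 by rewrite -deflation_sym -trmx_mul deflation_ker trmx0.
rewrite mul0mx scaler0 subr0 mulmxBl -scalemxAl -mulmxA xU.
by rewrite -scalemxAr scalerA.
Qed.

Lemma deflation_cube : S *m S *m S = U *m U *m U - l ^+ 3 *: (x^T *m x).
Proof.
rewrite deflation_sq [in LHS]mulmxBl -scalemxAl -(mulmxA x^T x S).
rewrite deflation_ker mulmx0 scaler0 subr0.
rewrite mulmxBr -scalemxAr mulmxA -(mulmxA U U x^T).
rewrite eigenvector_tr -scalemxAr eigenvector_tr -!scalemxAl !scalerA.
by congr (_ - _ *: _); ring.
Qed.

Lemma mxtrace_outer : \tr (x^T *m x) = 1.
Proof. by rewrite mxtrace_mulC. Qed.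

(** Subtracting [y^T *m y] may raise the rank by one, but the row space of [U] contains that of [S]
    and the line of [x], which meet in 0, so deflation takes the one back. *)
Lemma deflation_rank : (\rank S <= \rank P)%N.
Proof.
have rU : (\rank U <= \rank P + 1)%N.
  rewrite UP; apply: leq_trans (mxrank_add _ _) _.
  rewrite leq_add2l mxrank_opp; apply: leq_trans (mxrankM_maxr _ _) _.
  exact: rank_leq_row.
have xleU : (x <= U)%MS.
  have -> : x = (l^-1 *: x) *m U.
    by rewrite -scalemxAl xU scalerA mulVf ?scale1r ?lt_eqF.
  exact: submxMl.
have SleU : (S <= U)%MS.
  have -> : S = (1%:M - x^T *m x) *m U.
    by rewrite mulmxBl mul1mx -mulmxA xU -scalemxAr.
  exact: submxMl.
have dis : (S :&: x)%MS = 0.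
  apply/eqP; rewrite -submx0; apply/rV_subP => v; rewrite sub_capmx.
  case/andP=> /submxP[D vS] /sub_rVP[a vx].
  have : v *m x^T = 0.
    by rewrite vS -mulmxA -deflation_sym -trmx_mul deflation_ker trmx0 mulmx0.
  rewrite vx -scalemxAl unit_inner => /(congr1 mxtrace).
  rewrite linearZ /= mxtrace1 mulr1 raddf0 => ->.
  by rewrite scale0r sub0mx.
have xr : \rank x = 1%N.
  by rewrite rank_rV -mxtrace_mul_tr_eq0 x1 oner_eq0.
have h : (S + x <= U)%MS by rewrite addsmx_sub SleU.
have := leq_trans (mxrankS h) rU.
by rewrite mxrank_disjoint_sum // xr leq_add2r.
Qed.

End NegativeEigenvector.

End PositiveSemidefinite.

(** * The trace identity as a cubic inequality, and the resulting count *)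

Lemma psd_cubic_bound (R : realFieldType) n m (S : 'M[R]_n) (mu : R) :
    S^T = S -> psd S -> (\rank S <= m)%N -> (0 < m)%N -> \tr S = n%:R + mu ->
    0 <= mu ->
    \tr (S *m S *m S) - 3 * \tr (S *m S) = mu ^+ 3 + 3 * mu ^+ 2 - 2 * n%:R ->
    3 * m%:R <= 2 * (n%:R + mu) ->
  (n%:R + mu) ^+ 2 * (n%:R + mu - 3 * m%:R)
    <= m%:R ^+ 2 * (mu ^+ 3 + 3 * mu ^+ 2).
Proof.
move=> Ssym Spsd rS m0 trS mu0 tr3 nm.
have mR : 0 < m%:R :> R by rewrite ltr0n.
have mn0 : m%:R != 0 :> R by rewrite gt_eqF.
(* The mean of [m] eigenvalues with sum [\tr S]: tangency at the mean gives Jensen's inequality. *)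
pose q := (n%:R + mu) / m%:R.
have qm : q * m%:R = n%:R + mu by rewrite divfK.
have q3 : 3 <= 2 * q by rewrite mulrA ler_pdivlMr.
have := mxtrace_cubic_tangent Ssym Spsd rS q3.
rewrite tr3 trS -qm => h.
have n0 : 0 <= n%:R :> R by [].
have {}h : m%:R * q ^+ 2 * (q - 3) <= mu ^+ 3 + 3 * mu ^+ 2.
  rewrite -subr_ge0.
  have -> : mu ^+ 3 + 3 * mu ^+ 2 - m%:R * q ^+ 2 * (q - 3) =
    (mu ^+ 3 + 3 * mu ^+ 2 - 2 * n%:R + (6 * q - 3 * q ^+ 2) * (q * m%:R)
     + (2 * q ^+ 3 - 3 * q ^+ 2) * m%:R) + 2 * n%:R by ring.
  by rewrite addr_ge0 // mulr_ge0.
have -> : (q * m%:R) ^+ 2 * (q * m%:R - 3 * m%:R)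
    = m%:R ^+ 2 * (m%:R * q ^+ 2 * (q - 3)) by ring.
by rewrite ler_pM2l // exprn_gt0.
Qed.

(** The exponent 2/3 of the radius is decided here: with [m = t^3],
    [m^2 mu^3 = (mu t^2)^3 <= (2 c n)^3], a fraction of [n^3]. If the conclusion failed, then
    [n > 6 m] and the cubic inequality would apply. *)
Lemma cubic_bound_count (R : realFieldType) (c t n m mu : R) :
    1 <= t -> t ^+ 3 = m -> 0 <= c -> c < 1 / 2 -> 0 <= n -> 0 <= mu ->
    mu * t ^+ 2 <= 2 * c * n ->
    (3 * m <= 2 * (n + mu) ->
      (n + mu) ^+ 2 * (n + mu - 3 * m) <= m ^+ 2 * (mu ^+ 3 + 3 * mu ^+ 2)) ->
  n * (1 - 2 * c) <= 6 * m.
Proof.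
move=> t1 tm c0 c1 n0 mu0 mut h; rewrite leNgt; apply/negP => nm.
have m1 : 1 <= m by rewrite -tm exprn_ege1.
have n6 : 6 * m < n.
  by apply: lt_le_trans nm _; apply: ler_piMr => //; lra.
have {}h := h ltac:(lra).
have t2 : 0 <= t ^+ 2 by exact: sqr_ge0.
have mut0 : 0 <= mu * t ^+ 2 by exact: mulr_ge0.
have cn0 : 0 <= 2 * c * n by apply: mulr_ge0; lra.
have e1 : n ^+ 2 * (n - 3 * m) <= (n + mu) ^+ 2 * (n + mu - 3 * m).
  apply: ler_pM; rewrite ?sqr_ge0 //; try lra.
  by apply: lerXn2r; rewrite ?nnegrE; lra.
have e2 : m ^+ 2 * mu ^+ 3 <= (2 * c * n) ^+ 3.
  have -> : m ^+ 2 * mu ^+ 3 = (mu * t ^+ 2) ^+ 3 by rewrite -tm; ring.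
  exact: lerXn2r.
have e3 : m ^+ 2 * mu ^+ 2 <= n ^+ 2 * m.
  have -> : m ^+ 2 * mu ^+ 2 = (mu * t ^+ 2) ^+ 2 * t ^+ 2 by rewrite -tm; ring.
  apply: ler_pM; rewrite ?sqr_ge0 //; last by rewrite -tm; apply: ler_weXn2l.
  apply: lerXn2r; rewrite ?nnegrE //.
  by apply: le_trans mut _; rewrite ler_piMl //; lra.
(* Weakening [(2 * c) ^+ 3] to [2 * c] produces the factor [1 - 2 * c]. *)
have e4 : (2 * c * n) ^+ 3 <= n ^+ 2 * (2 * c * n).
  have -> : (2 * c * n) ^+ 3 = (2 * c) ^+ 2 * (n ^+ 2 * (2 * c * n)) by ring.
  apply: ler_piMl; first by rewrite mulr_ge0 ?sqr_ge0.
  by rewrite expr_le1 //; lra.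
have n2 : 0 < n ^+ 2 by rewrite exprn_gt0 //; lra.
have : n ^+ 2 * (n - 3 * m) <= n ^+ 2 * (2 * c * n + 3 * m).
  apply: le_trans e1 (le_trans h _).
  rewrite mulrDr [leRHS]mulrDr; apply: lerD; first exact: le_trans e2 e4.
  by rewrite (mulrCA _ 3) (mulrCA _ 3) ler_pM2l.
rewrite ler_pM2l // => e5.
by move: nm; rewrite ltNge => /negP; apply; lra.
Qed.

(** The trace of [B^3] sums over closed walks of length 3: a repeated vertex meets the zero diagonal
    of [B], and any other walk is a triangle. Expanding [U = B + 1] does the rest. *)
Lemma mxtrace_cube_triangle_free (R : realFieldType) n (U : 'M[R]_n) :
    U^T = U -> (forall i, U i i = 1) ->
    (forall i j k, i != j -> j != k -> i != k ->
      [\/ U i j = 0, U j k = 0 | U i k = 0]) ->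
  \tr (U *m U *m U) = 3 * \tr (U *m U) - 2 * n%:R.
Proof.
move=> Usym U1 tri; pose B := U - 1%:M.
have Bii i : B i i = 0 by rewrite !mxE eqxx U1 subrr.
have Bij i j : i != j -> B i j = U i j.
  by move=> /negbTE ij; rewrite !mxE ij subr0.
have Us i j : U i j = U j i by rewrite -{1}Usym mxE.
have trB3 : \tr (B *m B *m B) = 0.
  rewrite /mxtrace big1 // => i _; rewrite mxE big1 // => k _.
  rewrite mxE mulr_suml big1 // => j _.
  have [->|ij] := eqVneq i j; first by rewrite Bii !mul0r.
  have [->|jk] := eqVneq j k; first by rewrite Bii mulr0 mul0r.
  have [->|ik] := eqVneq i k; first by rewrite Bii mulr0.
  have ki : k != i by rewrite eq_sym.
  rewrite !Bij //; case: (tri i j k ij jk ik) => e.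
  - by rewrite e !mul0r.
  - by rewrite e mulr0 mul0r.
  - by rewrite (Us k) e mulr0.
have UB : U = B + 1%:M by rewrite /B subrK.
have trB : \tr B = 0 by rewrite /mxtrace big1.
have tr1 : \tr (1%:M : 'M[R]_n) = n%:R by rewrite mxtrace1.
clearbody B; rewrite UB !mulmxDr !mulmxDl !mulmx1 !mul1mx.
rewrite !mxtraceD trB3 trB tr1; ring.
Qed.

(** * The matrix of unit-distance defects, and the count of deep points *)

Section UnitDistanceDefect.
Variables (R : realFieldType) (n d : nat) (X : 'M[R]_(n, d)).
Let G := X *m X^T.
Let a i := 1 / 2 - G i i.

(* [1 - |x_i - x_j|^2] for the points [x_i = row i X]. *)
Definition defect : 'M[R]_n := \matrix_(i, j) (1 - (G i i + G j j - 2 * G i j)).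

Lemma gram_sym : G^T = G. Proof. by rewrite trmx_mul trmxK. Qed.

Lemma defectE i j : defect i j = 2 * G i j + a i + a j.
Proof. by rewrite mxE /a; field. Qed.

Lemma defect_diag i : defect i i = 1.
Proof. by rewrite mxE; ring. Qed.

Lemma gramC i j : G i j = G j i.
Proof. by rewrite -{1}gram_sym mxE. Qed.

Lemma defect_sym : defect^T = defect.
Proof. by apply/matrixP => i j; rewrite mxE !defectE gramC addrAC. Qed.

(** The expression is the squared length of [t x_i] minus the sum of the [x_j] over [T]. *)
Lemma gram_sum_ge0 (t : R) i (T : {set 'I_n}) :
  0 <= t ^+ 2 * G i i - 2 * t * \sum_(j in T) G i j
       + \sum_(j in T) \sum_(l in T) G j l.
Proof.
have -> : t ^+ 2 * G i i - 2 * t * \sum_(j in T) G i j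
    + \sum_(j in T) \sum_(l in T) G j l
  = \sum_c (t * X i c - \sum_(j in T) X j c) ^+ 2.
  have -> : G i i = \sum_c X i c ^+ 2.
    by rewrite mxE; apply: eq_bigr => c _; rewrite mxE expr2.
  have -> : \sum_(j in T) G i j = \sum_c X i c * \sum_(j in T) X j c.
    under eq_bigr => j _ do rewrite mxE.
    rewrite exchange_big; apply: eq_bigr => c _.
    by rewrite mulr_sumr; apply: eq_bigr => j _; rewrite mxE.
  have -> : \sum_(j in T) \sum_(l in T) G j l =
      \sum_c (\sum_(j in T) X j c) ^+ 2.
    under eq_bigr => j _ do
      [under eq_bigr => l _ do rewrite mxE; rewrite exchange_big].
    rewrite exchange_big; apply: eq_bigr => c _.
    rewrite expr2 mulr_suml; apply: eq_bigr => j _.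
    by rewrite mulr_sumr; apply: eq_bigr => l _; rewrite mxE.
  rewrite !mulr_sumr -sumrB -big_split /=; apply: eq_bigr => c _; ring.
by apply: sumr_ge0 => c _; rewrite sqr_ge0.
Qed.

(** With [w_j = t + a_j / (2 t)] and [y_j = t - a_j / (2 t)] one has
    [a_i + a_j = w_i w_j - y_i y_j]. The range allowed for [a_j] says exactly that
    [|y_j| <= 2 t]. *)
Lemma defect_split (t : R) : 0 < t ->
    (forall i, - (2 * t ^+ 2) <= a i /\ a i <= 6 * t ^+ 2) ->
  exists (P : 'M[R]_n) (y : 'rV[R]_n), [/\ defect = P - y^T *m y, psd P,
    (\rank P <= d.+1)%N & \tr (y *m y^T) <= 4 * t ^+ 2 * n%:R].
Proof.
move=> t0 ta; have tn0 : t != 0 by rewrite gt_eqF.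
pose w := \row_j (t + a j / (2 * t)); pose y := \row_j (t - a j / (2 * t)).
exists (2 *: G + w^T *m w), y; split.
- apply/matrixP => i j; rewrite defectE !mxE !big_ord1 !mxE.
  by rewrite -/(G i j); field.
- move=> z; rewrite mulmxDr mulmxDl mxtraceD -scalemxAr -scalemxAl linearZ /=.
  have -> : z *m G *m z^T = (z *m X) *m (z *m X)^T by rewrite trmx_mul !mulmxA.
  have -> : z *m (w^T *m w) *m z^T = (z *m w^T) *m (z *m w^T)^T.
    by rewrite trmx_mul trmxK !mulmxA.
  by rewrite addr_ge0 ?mulr_ge0 ?mxtrace_mul_tr_ge0.
- apply: leq_trans (mxrank_add _ _) _; rewrite -(addn1 d); apply: leq_add.
    apply: leq_trans (mxrank_scale _ _) _.
    apply: leq_trans (mxrankM_maxl _ _) _.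
    exact: rank_leq_col.
  by apply: leq_trans (mxrankM_maxr _ _) _; exact: rank_leq_row.
- have -> : 4 * t ^+ 2 * n%:R = \sum_(i < n) 4 * t ^+ 2 :> R.
    by rewrite sumr_const card_ord mulr_natr.
  rewrite /mxtrace big_ord1 mxE; apply: ler_sum => i _; rewrite !mxE -expr2.
  have -> : 4 * t ^+ 2 = (2 * t) ^+ 2 by ring.
  have [l r] := ta i; have t2 : 0 < 2 * t by rewrite mulr_gt0.
  have {}l : - t <= a i / (2 * t) by rewrite ler_pdivlMr //; lra.
  have {}r : a i / (2 * t) <= 3 * t by rewrite ler_pdivrMr //; lra.
  by rewrite -subr_ge0 subr_sqr mulr_ge0 //; lra.
Qed.

Hypothesis tri : forall i j k, i != j -> j != k -> i != k ->
  [\/ defect i j = 0, defect j k = 0 | defect i k = 0].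

(* The points at non-unit distance from [x_i] form a regular unit simplex. *)
Lemma defect_row_sum (t : R) i : 0 < t -> (forall j, 1 <= 2 * t ^+ 2 * a j) ->
  \sum_j defect i j <= 3 / 2 + t + t ^+ 2 * a i.
Proof.
move=> t0.
have aE j : G j j = 1 / 2 - a j by rewrite /a subKr.
have defE := defectE; have gram0 := gram_sum_ge0.
clearbody a; clearbody G => ta.
have a0 j : 0 < a j.
  have t2 : 0 < 2 * t ^+ 2 by rewrite mulr_gt0 ?exprn_gt0.
  by rewrite -(pmulr_rgt0 _ t2) (lt_le_trans ltr01).
pose T := [set j | (j != i) && (defect i j != 0)].
pose k : R := #|T|%:R; pose s := \sum_(j in T) a j.
have k0 : 0 <= k by [].
have s0 : 0 <= s by apply: sumr_ge0 => j _; exact: ltW.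
have GTT : 2 * \sum_(j in T) \sum_(l in T) G j l = k - 2 * k * s.
  have e j : j \in T -> 2 * \sum_(l in T) G j l = 1 - k * a j - s.
    move=> jT.
    (* On [T] the defect is the identity matrix: two points at non-unit distance from [x_i] are at
       unit distance from each other. *)
    have : \sum_(l in T) defect j l = 1.
      rewrite (bigD1 j) //= defect_diag big1 ?addr0 // => l /andP[lT lj].
      move: jT lT; rewrite !inE => /andP[ji d1] /andP[li d2].
      case: (@tri i j l); rewrite 1?eq_sym //.
      - by move=> e; rewrite e eqxx in d1.
      - by move=> e; rewrite e eqxx in d2.
    under eq_bigr => l _ do rewrite defE.
    rewrite !big_split /= -mulr_sumr sumr_const.
    rewrite -[a j *+ _]mulr_natl -/k -/s => e1; lra.
  rewrite mulr_sumr (eq_bigr _ e) !sumrB -mulr_sumr !sumr_const.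
  rewrite -/s -[s *+ _]mulr_natl -/k.
  ring.
have Ri : \sum_j defect i j = 1 + 2 * \sum_(j in T) G i j + k * a i + s.
  rewrite (bigD1 i) //= defect_diag (bigID (mem T)) /=.
  rewrite [X in 1 + (_ + X)]big1 ?addr0.
    rewrite -!addrA; congr (_ + _).
    rewrite (eq_bigl (mem T)); last first.
      by move=> j; rewrite !inE; case: (j != i).
    under eq_bigr => l _ do rewrite defE.
    by rewrite !big_split /= -mulr_sumr sumr_const -[a i *+ _]mulr_natl addrA.
  by move=> j /andP[ji]; rewrite inE ji /= negbK => /eqP.
(* [h0] concerns the squared length of the sum over [T] and, with [ta], yields [s <= 1 / 2] and
   [k <= t ^+ 2]; [ht] then bounds the inner product of [x_i] with that sum. *)
have h0 := gram0 0 i T; have ht := gram0 t i T.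
have k_ks : 0 <= k * (1 - 2 * s).
  have -> : k * (1 - 2 * s) = 2 * \sum_(j in T) \sum_(l in T) G j l.
    by rewrite GTT; ring.
  rewrite mulr_ge0 //; move: h0; congr (0 <= _); ring.
have kts : k <= 2 * t ^+ 2 * s.
  by rewrite /k -sum1_card natr_sum mulr_sumr; apply: ler_sum => j _; exact: ta.
have [kt s2] : k <= t ^+ 2 /\ s <= 1 / 2.
  have [k0'|kn0] := eqVneq k 0.
    split; first by rewrite k0' sqr_ge0.
    have T0 : T = finset.set0.
      by apply/eqP; rewrite -cards_eq0 -(pnatr_eq0 R) -/k k0'.
    by rewrite /s T0 finset.big_set0; lra.
  have kp : 0 < k by rewrite lt_neqAle eq_sym kn0.
  have s2 : s <= 1 / 2 by move: k_ks; rewrite pmulr_rge0 //; lra.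
  split=> //; apply: le_trans kts _.
  have := ler_wpM2l (sqr_ge0 t) s2; lra.
have h1 : 2 * \sum_(j in T) G i j <= t.
  rewrite -(ler_pM2l t0).
  have e1 := mulr_ge0 (sqr_ge0 t) (ltW (a0 i)).
  have e2 := mulr_ge0 k0 s0.
  by move: ht; rewrite aE; lra.
have := ler_wpM2r (ltW (a0 i)) kt.
rewrite Ri; lra.
Qed.

(** Double counting: with [s] the sum of the [a_j], the entries add up to at least [2 n s] and at
    most [n (3 / 2 + t) + t^2 s]. As [n <= 2 t^2 s], dividing by [s] leaves [n <= 2 t^2 + t^3]. *)
Lemma defect_deep_count (t : R) : 1 <= t -> (forall j, 1 <= 2 * t ^+ 2 * a j) ->
  n%:R <= 3 * t ^+ 3.
Proof.
move=> t1 ta; have t0 : 0 < t by exact: lt_le_trans ltr01 t1.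
have Ri i := defect_row_sum i t0 ta; have defE := defectE.
have : 0 <= \sum_i \sum_j G i j.
  have -> : \sum_i \sum_j G i j = \sum_c (\sum_j X j c) ^+ 2.
    under eq_bigr => j _ do
      [under eq_bigr => l _ do rewrite mxE; rewrite exchange_big].
    rewrite exchange_big; apply: eq_bigr => c _.
    rewrite expr2 mulr_suml; apply: eq_bigr => j _.
    by rewrite mulr_sumr; apply: eq_bigr => l _; rewrite mxE.
  by apply: sumr_ge0 => c _; rewrite sqr_ge0.
clearbody a; clearbody G => G0.
have [n0|n0] := posnP n; first by rewrite n0 mulr_ge0 ?exprn_ge0 ?ltW.
set s := \sum_j a j.
have sumU : \sum_i \sum_j defect i j = 2 * \sum_i \sum_j G i j + 2 * n%:R * s.
  have e i : \sum_j defect i j = 2 * \sum_j G i j + n%:R * a i + s.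
    under eq_bigr => l _ do rewrite defE.
    rewrite !big_split /= -mulr_sumr sumr_const card_ord.
    by rewrite -[a i *+ _]mulr_natl.
  rewrite (eq_bigr _ (fun i _ => e i)) !big_split /= -!mulr_sumr sumr_const.
  rewrite card_ord -/s -[s *+ _]mulr_natl; ring.
have ns : n%:R <= 2 * t ^+ 2 * s.
  rewrite -{1}[n]card_ord -sum1_card natr_sum mulr_sumr.
  by apply: ler_sum => j _; exact: ta.
have : \sum_i \sum_j defect i j <= \sum_(i < n) (3 / 2 + t + t ^+ 2 * a i).
  by apply: ler_sum => i _; exact: Ri.
rewrite sumU big_split /= sumr_const card_ord -mulr_sumr -/s -mulr_natl => h.
have t2 : 0 < 2 * t ^+ 2 by rewrite mulr_gt0 ?exprn_gt0.
have s0 : 0 < s by rewrite -(pmulr_rgt0 _ t2) (lt_le_trans _ ns) ?ltr0n.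
have t3 : 0 <= 3 / 2 + t by lra.
have e1 := ler_wpM2l t3 ns.
have e2 : t ^+ 2 <= t ^+ 3 by exact: ler_weXn2l.
have : s * (2 * n%:R) <= s * (4 * t ^+ 2 + 2 * t ^+ 3).
  have -> : s * (4 * t ^+ 2 + 2 * t ^+ 3) =
      (3 / 2 + t) * (2 * t ^+ 2 * s) + t ^+ 2 * s.
    by field.
  by move: G0 h e1; lra.
rewrite ler_pM2l //; lra.
Qed.

End UnitDistanceDefect.

(** * Negative eigenvectors by compactness, and the count of shell points *)

Import numFieldNormedType.Exports.
Local Open Scope classical_set_scope.
Local Open Scope ring_scope.

Lemma continuous_quadratic_form (R : realType) n (M : 'M[R]_n) :
  continuous (fun z : 'rV[R]_n => \tr (z *m M *m z^T)).
Proof.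
have -> : (fun z : 'rV[R]_n => \tr (z *m M *m z^T)) =
    (fun z => \sum_j (\sum_k z ord0 k * M k j) * z ord0 j).
  apply/funext => z; rewrite /mxtrace big_ord1 mxE.
  by apply: eq_bigr => j _; rewrite !mxE.
apply: continuous_big => [|j _]; first exact: add_continuous.
move=> z; apply: continuousM; last exact: coord_continuous.
apply: continuous_big => [|k _]; first exact: add_continuous.
move=> {}z; apply: continuousM; first exact: coord_continuous.
exact: cst_continuous.
Qed.

(** Take a minimiser [c] of the form on the unit sphere: [U] minus the minimum times the identity is
    positive semidefinite with form vanishing at [c], so [psd_ker] applies. *)
Lemma negative_eigenvector (R : realType) n (U : 'M[R]_n) :
    U^T = U -> ~ psd U ->
  exists (x : 'rV_n) (l : R), [/\ \tr (x *m x^T) = 1, x *m U = l *: x & l < 0].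
Proof.
move=> Usym /existsNP[z /negP]; rewrite -ltNge => zU.
pose f (z : 'rV[R]_n) := \tr (z *m U *m z^T).
pose N (z : 'rV[R]_n) := \tr (z *m z^T).
have N0 u : u != 0 -> 0 < N u.
  move=> u0; rewrite lt_neqAle eq_sym mxtrace_mul_tr_eq0 u0.
  exact: mxtrace_mul_tr_ge0.
have fZ a u : f (a *: u) = a ^+ 2 * f u.
  by rewrite /f [(_ *: u)^T]linearZ /= -!scalemxAl -scalemxAr !linearZ /=; ring.
have NZ a u : N (a *: u) = a ^+ 2 * N u.
  by rewrite /N [(_ *: u)^T]linearZ /= -!scalemxAl -scalemxAr !linearZ /=; ring.
have z0 : z != 0.
  by apply/eqP => z0; rewrite z0 mul0mx mul0mx linear0 ltxx in zU.
pose A := [set u | N u = 1].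
have nrm u : u != 0 -> A ((Num.sqrt (N u))^-1 *: u).
  move=> u0; rewrite /A /= NZ exprVn sqr_sqrtr ?ltW ?N0 // mulVf //.
  by rewrite gt_eqF ?N0.
have A0 : A !=set0 by exists ((Num.sqrt (N z))^-1 *: z); exact: nrm.
have Acl : closed A.
  have -> : A = (fun u => \tr (u *m 1%:M *m u^T)) @^-1` [set x | x = 1].
    by apply/seteqP; split=> u; rewrite /A /= mulmx1.
  apply: preimage_closed; last exact: closed_eq.
  by move=> u _; exact: continuous_quadratic_form.
(* The norm here is the sup norm, so it suffices to bound each coordinate. *)
have Abd : bounded_set A.
  exists 1; split; first exact: real1.
  move=> M M1 u Au /=; rewrite [leLHS]/Num.Def.normr /= mx_normrE.
  apply: bigmax_le => [|[i j] _] /=; first exact: le_trans ler01 (ltW M1).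
  apply: le_trans (ltW M1).
  rewrite (ord1 i) -(@expr_le1 _ 2) // -normrX ger0_norm ?sqr_ge0 //.
  rewrite -[leRHS]Au /N /mxtrace big_ord1 mxE (bigD1 j) //= mxE -expr2.
  by rewrite lerDl sumr_ge0 // => k _; rewrite mxE -expr2 sqr_ge0.
have [c /set_mem cA cmin] := EVT_min_rV A0 (bounded_closed_compact Abd Acl)
  (continuous_subspaceT (@continuous_quadratic_form R n U)).
have {}cmin u : A u -> f c <= f u by move=> Au; apply: cmin; apply/mem_set.
have shift u : \tr (u *m (U - (f c)%:M) *m u^T) = f u - f c * N u.
  by rewrite mulmxBr mulmxBl linearB /= mul_mx_scalar -scalemxAl linearZ.
exists c, (f c); split=> //.
- apply/eqP; rewrite -subr_eq0 -mul_mx_scalar -mulmxBr; apply/eqP/psd_ker.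
  + by rewrite linearB /= Usym tr_scalar_mx.
  + move=> u; rewrite shift; have [->|u0] := eqVneq u 0.
      by rewrite /f /N !mul0mx linear0 mulr0 subrr.
    have := cmin _ (nrm u u0); rewrite fZ exprVn (sqr_sqrtr (ltW (N0 u u0))).
    by rewrite [_ * f u]mulrC ler_pdivlMr ?N0 // subr_ge0.
  + by rewrite shift (cA : N c = 1) mulr1 subrr.
- apply: le_lt_trans (cmin _ (nrm z z0)) _.
  by rewrite fZ pmulr_rlt0 // exprn_gt0 // invr_gt0 sqrtr_gt0 N0.
Qed.

(** [mu] is 0 if [U] is positive semidefinite, and otherwise minus the eigenvalue removed by
    deflation. *)
Lemma rank_one_perturbation_count (R : realType) n m (U P : 'M[R]_n)
    (y : 'rV_n) :
    U^T = U -> U = P - y^T *m y -> psd P -> (\rank P <= m)%N -> (0 < m)%N ->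
    \tr U = n%:R -> \tr (U *m U *m U) = 3 * \tr (U *m U) - 2 * n%:R ->
  exists mu : R, [/\ 0 <= mu, mu <= \tr (y *m y^T) &
    3 * m%:R <= 2 * (n%:R + mu) ->
    (n%:R + mu) ^+ 2 * (n%:R + mu - 3 * m%:R)
      <= m%:R ^+ 2 * (mu ^+ 3 + 3 * mu ^+ 2)].
Proof.
move=> Usym UP Ppsd rP m0 trU trU3.
have [Upsd|nUpsd] := pselect (psd U).
  exists 0; split=> //; first exact: mxtrace_mul_tr_ge0.
  apply: (@psd_cubic_bound _ _ _ U) => //; rewrite ?addr0 //.
    exact: leq_trans (psd_rank_sub_sq Usym UP Ppsd Upsd) rP.
  by rewrite trU3; ring.
have [x [l [x1 xU l0]]] := negative_eigenvector Usym nUpsd.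
exists (- l); split.
- by rewrite oppr_ge0 ltW.
- exact: (negative_eigen_bound UP Ppsd x1 xU).
have trB (B : 'M[R]_n) a : \tr (B - a *: (x^T *m x)) = \tr B - a.
  by rewrite linearB linearZ /= (mxtrace_outer x1) mulr1.
apply: (@psd_cubic_bound _ _ _ (U - l *: (x^T *m x))) => //.
- exact: deflation_sym.
- exact: (deflation_psd Usym UP Ppsd x1 xU l0).
- exact: leq_trans (deflation_rank Usym UP x1 xU l0) rP.
- by rewrite trB trU.
- by rewrite oppr_ge0 ltW.
- rewrite (deflation_cube Usym x1 xU) (deflation_sq Usym x1 xU).
  by rewrite !trB trU3; ring.
Qed.

Lemma defect_shell_count (R : realType) n d (X : 'M[R]_(n, d)) (c t : R) :
    (forall i j k, i != j -> j != k -> i != k ->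
      [\/ defect X i j = 0, defect X j k = 0 | defect X i k = 0]) ->
    1 <= t -> t ^+ 3 = d.+1%:R -> 0 < c -> c < 1 / 2 ->
    (forall i, - (c / t ^+ 2) <= 1 / 2 - (X *m X^T) i i <= 3 * (c / t ^+ 2)) ->
  n%:R * (1 - 2 * c) <= 6 * d.+1%:R.
Proof.
move=> tri t1 td c0 c1 ha.
have t0 : 0 < t by exact: lt_le_trans ltr01 t1.
set e := c / t ^+ 2 in ha.
have e0 : 0 < e by rewrite divr_gt0 ?exprn_gt0.
(* Chosen so that [2 r^2 = e]: the shell is then the range required by [defect_split], whose bound
   [4 r^2 n] is [2 e n]. *)
pose r := Num.sqrt (e / 2).
have r2 : r ^+ 2 = e / 2 by rewrite sqr_sqrtr // divr_ge0 ?ltW.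
have r0 : 0 < r by rewrite sqrtr_gt0 divr_gt0.
have hr i : - (2 * r ^+ 2) <= 1 / 2 - (X *m X^T) i i /\
    1 / 2 - (X *m X^T) i i <= 6 * r ^+ 2.
  by rewrite r2; case/andP: (ha i) => ? ?; split; lra.
have [P [y [UP Ppsd rP yb]]] := defect_split r0 hr.
have trU : \tr (defect X) = n%:R.
  rewrite /mxtrace (eq_bigr (fun=> 1)) => [|i _]; last exact: defect_diag.
  by rewrite sumr_const card_ord.
have trU3 := mxtrace_cube_triangle_free (defect_sym X) (defect_diag X) tri.
have [mu [mu0 muy h]] := rank_one_perturbation_count (defect_sym X) UP Ppsd rP
  (ltn0Sn d) trU trU3.
apply: (cubic_bound_count t1 td (ltW c0) c1 (ler0n _ n) mu0 _ h).
rewrite -ler_pdivlMr ?exprn_gt0 //; apply: le_trans muy (le_trans yb _).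
by rewrite r2 /e le_eqVlt; apply/orP; left; apply/eqP; field; rewrite gt_eqF.
Qed.

(** * From points in the ball to matrices *)

Definition sqnorm (R : realType) d (x : 'rV[R]_d) : R := \sum_j x ord0 j ^+ 2.

Definition centered_mx (R : realType) d (p : 'rV[R]_d) (s : seq 'rV[R]_d) :
  'M[R]_(size s, d) := \matrix_(i, j) (s`_i - p) ord0 j.

Lemma gram_centered (R : realType) d (p : 'rV[R]_d) (s : seq 'rV[R]_d) i :
  (centered_mx p s *m (centered_mx p s)^T) i i = sqnorm (p - s`_i).
Proof.
rewrite mxE; apply: eq_bigr => j _.
by rewrite !mxE -expr2 -sqrrN opprB.
Qed.

Lemma defect_centered (R : realType) d (p : 'rV[R]_d) (s : seq 'rV[R]_d) i j :
  defect (centered_mx p s) i j = 1 - sqnorm (s`_i - s`_j).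
Proof.
rewrite mxE; congr (_ - _); rewrite !mxE mulr_sumr -big_split -sumrB /=.
by apply: eq_bigr => k _; rewrite !mxE; ring.
Qed.

Lemma almost_equidistant_defect (R : realType) d (V : set 'rV[R]_d) p s :
    almost_equidistant V -> uniq s -> {in s, forall x, V x} ->
    let U := defect (centered_mx p s) in
  forall i j k, i != j -> j != k -> i != k ->
    [\/ U i j = 0, U j k = 0 | U i k = 0].
Proof.
move=> ae us sV U i j k ij jk ik; rewrite /U !defect_centered.
have sub (a b : 'I_(size s)) : a != b -> s`_a <> s`_b.
  by move=> ab /eqP; rewrite nth_uniq //; apply/negP.
have sq1 x : enorm x = 1 -> 1 - sqnorm x = 0 :> R.
  move=> /(congr1 (fun z => z ^+ 2)); rewrite sqr_sqrtr.
    by rewrite expr1n /sqnorm => ->; rewrite subrr.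
  by apply: sumr_ge0 => ? _; rewrite sqr_ge0.
have sVn (a : 'I_(size s)) : V s`_a by apply: sV; rewrite mem_nth.
case: (ae _ _ _ (sVn i) (sVn j) (sVn k) (sub _ _ ij) (sub _ _ jk) (sub _ _ ik)).
- by move=> /sq1; constructor 1.
- by move=> /sq1; constructor 2.
- by move=> /sq1; constructor 3.
Qed.

(** Split at depth [3 c / t^2]: with [m = d + 1], the deep points contribute [3 m] and the shell
    points [6 m]. *)
Lemma almost_equidistant_ball_size (R : realType) d (V : set 'rV[R]_d) p s
    (c t : R) :
    almost_equidistant V -> uniq s -> {in s, forall x, V x} ->
    {in s, forall x, sqnorm (p - x) <= 1 / 2 + c / t ^+ 2} ->
    1 <= t -> t ^+ 3 = d.+1%:R -> 1 / 4 <= c -> c < 1 / 2 ->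
  (size s)%:R * (1 - 2 * c) <= 9 * d.+1%:R.
Proof.
move=> ae us sV sball t1 td c4 c2.
have t2 : 0 < t ^+ 2 by rewrite exprn_gt0 // (lt_le_trans ltr01).
pose deep x := 3 * (c / t ^+ 2) < 1 / 2 - sqnorm (p - x).
pose s1 := [seq x <- s | deep x]; pose s2 := [seq x <- s | ~~ deep x].
have sz : size s = (size s1 + size s2)%N by rewrite !size_filter count_predC.
have sub1 x : x \in s1 -> deep x /\ x \in s by rewrite mem_filter => /andP[].
have sub2 x : x \in s2 -> ~~ deep x /\ x \in s by rewrite mem_filter => /andP[].
have tri1 := almost_equidistant_defect p ae (filter_uniq _ us)
  (fun x h => sV x (sub1 x h).2).
have tri2 := almost_equidistant_defect p ae (filter_uniq _ us)
  (fun x h => sV x (sub2 x h).2).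
have h1 : (size s1)%:R <= 3 * d.+1%:R :> R.
  rewrite -td; apply: (defect_deep_count tri1 t1) => j.
  have [dj _] := sub1 _ (mem_nth 0 (ltn_ord j)).
  rewrite gram_centered.
  have t2' : 0 <= 2 * t ^+ 2 by rewrite mulr_ge0 ?ltW.
  have tc : 2 * t ^+ 2 * (3 * (c / t ^+ 2)) = 6 * c.
    by field; rewrite -sqrf_eq0 gt_eqF.
  (* The bound [1 / 4 <= c] enters here, through [1 <= 6 c]. *)
  by apply: le_trans (ler_wpM2l t2' (ltW dj)); rewrite tc; lra.
have h2 : (size s2)%:R * (1 - 2 * c) <= 6 * d.+1%:R.
  apply: (defect_shell_count tri2 t1 td) => //; first by lra.
  move=> j; have [dj sj] := sub2 _ (mem_nth 0 (ltn_ord j)).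
  rewrite gram_centered; apply/andP; split; last by rewrite leNgt.
  by have := sball _ sj; lra.
rewrite sz natrD mulrDl.
have : (size s1)%:R * (1 - 2 * c) <= (size s1)%:R by apply: ler_piMr => //; lra.
lra.
Qed.

Theorem theorem11 (R : realType) :
  exists C : R, 0 < C /\
    forall (c0 : R) (d : nat), 0 <= c0 -> c0 < 1 / 2 -> (1 <= d)%N ->
    forall V : set 'rV[R]_d, almost_equidistant V ->
    forall p : 'rV[R]_d,
      V `<=` closed_ball_ (@enorm R d) p
               (Num.sqrt (1 / 2 + c0 / (d.+1%:R `^ (2 / 3)))) ->
      finite_set V /\
      (#|` fset_set V|)%:R <= C * d%:R / (1 - 2 * c0).
Proof.
(* [36 = 9 * 2 * 2]: one factor 2 pays for raising [c0] to at least [1 / 4], the other for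
   [d + 1 <= 2 d]. *)
exists 36; split=> // c0 d c00 c02 d1 V ae p Vp.
pose c : R := Num.max c0 (1 / 4).
pose t : R := d.+1%:R `^ (1 / 3).
have c02' : 0 < 1 - 2 * c0 by lra.
have t1 : 1 <= t.
  by rewrite -[leLHS](powRr0 d.+1%:R) ler_powR ?ler1n // divr_ge0.
have td : t ^+ 3 = d.+1%:R.
  by rewrite -powR_mulrn ?powR_ge0 // -powRrM divfK // powRr1.
have t2 : t ^+ 2 = d.+1%:R `^ (2 / 3).
  by rewrite -powR_mulrn ?powR_ge0 // -powRrM; congr (_ `^ _); field.
have c4 : 1 / 4 <= c by rewrite le_max lexx orbT.
have c0c : c0 <= c by rewrite le_max lexx.
have c2 : c < 1 / 2 by rewrite gt_max c02; lra.
have c12 : 1 - 2 * c0 <= 2 * (1 - 2 * c).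
  by rewrite /c; case: (lerP c0 (1 / 4)); lra.
have tp : 0 < t ^+ 2 by rewrite exprn_gt0 // (lt_le_trans ltr01).
have ball x : V x -> sqnorm (p - x) <= 1 / 2 + c / t ^+ 2.
  move=> /Vp; rewrite /closed_ball_ /= /enorm -t2 ler_sqrt.
    by move/le_trans; apply; rewrite lerD2l ler_pM2r // invr_gt0.
  by rewrite addr_ge0 // divr_ge0 // ltW.
have count (s : seq 'rV[R]_d) : uniq s -> {in s, forall x, V x} ->
    (size s)%:R <= 36 * d%:R / (1 - 2 * c0).
  move=> us sV; rewrite ler_pdivlMr //.
  have h := almost_equidistant_ball_size ae us sV (fun x h => ball x (sV x h))
    t1 td c4 c2.
  have h' := ler_wpM2l (ler0n R (size s)) c12.
  have : d.+1%:R <= 2 * d%:R :> R.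
    by rewrite -natrM ler_nat mul2n -addnn -addn1 leq_add2l.
  by move: h h'; lra.
have finV : finite_set V.
  (* An infinite [V] would contain a finite subset larger than the bound [count]. *)
  apply: contrapT => /infinite_set_fset infV.
  have [B BV] := infV (Num.truncn (36 * d%:R / (1 - 2 * c0))).+1.
  apply/negP; rewrite -ltnNge -(ltr_nat R); apply: le_lt_trans (truncnS_gt _).
  by apply: count; [exact: fset_uniq | move=> x xB; exact: BV].
(* Finiteness has to come first: only then does [fset_set V] have the elements of [V]. *)
split=> //; apply: count; first exact: fset_uniq.
by move=> x; rewrite in_fset_set // inE.
Qed.
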